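(* Let $n\ge 1$, $R>0$, $a>0$, $\lambda\in\mathbb R$ and $\lambda_1,\dots,\lambda_n\in\mathbb R\setminus\{0\}$. Consider the equations of motion of a circular cylinder and $n$ point vortices in a perfect fluid (written out in the context) for the phase vector $\zeta=(x_c,y_c,v_1,v_2,x_1,y_1,\dots,x_n,y_n)$ on the phase space $M$. These equations can be represented in Hamiltonian form: there exist a smooth function $H:M\to\mathbb R$ (the Hamiltonian) and a smooth skew-symmetric tensor $J_{ij}(\zeta)=\{\zeta_i,\zeta_j\}$ on $M$ such that the equations of motion are $$\dot\zeta_i=\{\zeta_i,H\}=\sum_k\{\zeta_i,\zeta_k\}\frac{\partial H}{\partial\zeta_k}\qquad\text{for all } i,$$ and $J$ satisfies the Jacobi identity $$\sum_l\left(J_{il}\frac{\partial J_{jk}}{\partial\zeta_l}+J_{kl}\frac{\partial J_{ij}}{\partial\zeta_l}+J_{jl}\frac{\partial J_{ki}}{\partial\zeta_l}\right)=0\qquad\text{for all } i,j,k.$$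
   Context: Setting: a cylinder (disk) of radius $R$ in the plane with center $\mathbf r_c=(x_c,y_c)$ (in a fixed frame) and velocity $\mathbf v=(v_1,v_2)$; $\mathbf r_i=(x_i,y_i)$ is the vector from the center of the cylinder to the $i$-th vortex; $\tilde{\mathbf r}_i=(\tilde x_i,\tilde y_i)=\frac{R^2}{|\mathbf r_i|^2}\mathbf r_i$ is the vector from the center of the cylinder to the $i$-th inverse point. The constants are $a$ (involving the added mass), $\lambda$ (related to the circulation around the cylinder) and $\lambda_i$ (vortex strengths). Phase space: $M=\{\zeta\in\mathbb R^{4+2n}: |\mathbf r_i|>R \text{ for all } i,\ \mathbf r_i\ne\mathbf r_j \text{ for } i\neq j\}$. Velocity potential at $\mathbf r=(x,y)$, $|\mathbf r|>R$ (multivalued, but with single-valued gradient): $$\varphi(\mathbf r)=-\frac{R^2}{|\mathbf r|^2}(\mathbf r,\mathbf v)-\lambda\arctan\frac yx+\sum_{i=1}^n\lambda_i\left(\arctan\frac{y-\tilde y_i}{x-\tilde x_i}-\arctan\frac{y-y_i}{x-x_i}\right).$$ Let $\tilde\varphi_i$ be the part of $\varphi$ without singularity at $\mathbf r=\mathbf r_i$, i.e. $\varphi$ with the term $-\lambda_i\arctan\frac{y-y_i}{x-x_i}$ removed. Equations of motion: $$\dot{\mathbf r}_i=-\mathbf v+\operatorname{grad}\tilde\varphi_i\big|_{\mathbf r=\mathbf r_i}\ (i=1,\dots,n),\qquad \dot{\mathbf r}_c=\mathbf v,$$ $$a\dot v_1=\lambda v_2-\sum_{i=1}^n\lambda_i(\dot{\tilde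 y}_i-\dot y_i),\qquad a\dot v_2=-\lambda v_1+\sum_{i=1}^n\lambda_i(\dot{\tilde x}_i-\dot x_i),$$ where $\dot{\tilde x}_i,\dot{\tilde y}_i$ are time derivatives of $\tilde x_i,\tilde y_i$, expressed through $\mathbf r_i$ and $\dot{\mathbf r}_i$. *)

(* Defs.v *)
From HB Require Import structures.
From mathcomp Require Import all_boot all_order all_algebra.
From mathcomp Require Import all_classical all_reals all_analysis.
Set Implicit Arguments.
Unset Strict Implicit.
Unset Printing Implicit Defensive.
Import Order.TTheory GRing.Theory Num.Theory.
Import numFieldNormedType.Exports.
Local Open Scope classical_set_scope.
Local Open Scope ring_scope.

Definition dotp (R : realType) (N : nat) (u v : 'rV[R]_N) : R :=
  \sum_(k < N) u 0 k * v 0 k.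

(* The library norm `|u| on row vectors is the maximum norm; distances in the
   plane are Euclidean. *)
Definition enorm (R : realType) (N : nat) (u : 'rV[R]_N) : R :=
  Num.sqrt (dotp u u).

Definition partial (R : realType) (N : nat) (k : 'I_N) (f : 'rV[R]_N -> R) :
    'rV[R]_N -> R :=
  fun p => derive f p (delta_mx 0 k).

Definition grad (R : realType) (N : nat) (f : 'rV[R]_N -> R) (p : 'rV[R]_N) :
    'rV[R]_N :=
  \row_k partial k f p.

Definition iter_partial (R : realType) (N : nat) (ks : seq 'I_N)
    (f : 'rV[R]_N -> R) : 'rV[R]_N -> R :=
  foldr (@partial R N) f ks.

(* C^oo on D, meant for open D: partial derivatives of every order exist and
   are continuous at the points of D.  Values of f off D play no role. *)
Definition smooth_on (R : realType) (N : nat) (D : set 'rV[R]_N)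
    (f : 'rV[R]_N -> R) : Prop :=
  forall (ks : seq 'I_N) (p : 'rV[R]_N), D p ->
    {for p, continuous (iter_partial ks f)} /\
    (forall k : 'I_N, derivable (iter_partial ks f) p (delta_mx 0 k)).

(* zeta = (x_c, y_c, v_1, v_2, x_1, y_1, ..., x_n, y_n); vec_mx is row-major. *)
Notation phase R n := 'rV[R]_(2 + 2 + n * 2).

Definition center (R : realType) (n : nat) (z : phase R n) : 'rV[R]_2 :=
  lsubmx (lsubmx z).

Definition velocity (R : realType) (n : nat) (z : phase R n) : 'rV[R]_2 :=
  rsubmx (lsubmx z).

Definition vortex (R : realType) (n : nat) (z : phase R n) (i : 'I_n) :
    'rV[R]_2 :=
  row i (vec_mx (rsubmx z)).

Definition phase_space (R : realType) (n : nat) (rad : R) : set (phase R n) :=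
  [set z | (forall i, rad < enorm (vortex z i)) /\
           (forall i j, i != j -> vortex z i != vortex z j)].

Definition inverse_point (R : realType) (rad : R) (r : 'rV[R]_2) : 'rV[R]_2 :=
  (rad ^+ 2 / enorm r ^+ 2) *: r.

(* A branch of the multivalued arctan (y / x), p = (x, y), which is smooth
   near the base point p0 <> 0.  On the axis x = 0, where y / x is undefined,
   the branch arccot (x / y) = pi / 2 - atan (x / y) is used instead: it has
   the same tangent y / x wherever x and y are nonzero.  Two branches differ
   by a locally constant function, so gradients do not depend on the choice. *)
Definition arctan_branch (R : realType) (p0 p : 'rV[R]_2) : R :=
  if p0 0 0 != 0 then atan (p 0 1 / p 0 0) else pi / 2 - atan (p 0 0 / p 0 1).

(* The branch, near the base point p0, of the velocity potential in which only
   the singular terms of the vortices selected by P are kept: xpredT gives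
   phi, and predC1 i gives its part without singularity at the i-th vortex. *)
Definition potential (R : realType) (n : nat) (rad lam : R) (lams : 'I_n -> R)
    (P : pred 'I_n) (z : phase R n) (p0 p : 'rV[R]_2) : R :=
  - (rad ^+ 2 / enorm p ^+ 2) * dotp p (velocity z)
  - lam * arctan_branch p0 p
  + (\sum_(i < n) lams i *
       arctan_branch (p0 - inverse_point rad (vortex z i))
                     (p - inverse_point rad (vortex z i))
     - \sum_(i < n | P i) lams i *
         arctan_branch (p0 - vortex z i) (p - vortex z i)).

Definition grad_regular_potential (R : realType) (n : nat) (rad lam : R)
    (lams : 'I_n -> R) (i : 'I_n) (z : phase R n) : 'rV[R]_2 :=
  grad (potential rad lam lams (predC1 i) z (vortex z i)) (vortex z i).

Definition equations_of_motion (R : realType) (n : nat) (rad a lam : R)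
    (lams : 'I_n -> R) (zeta : R -> phase R n) (t : R) : Prop :=
  let x i s := vortex (zeta s) i 0 0 in
  let y i s := vortex (zeta s) i 0 1 in
  let x' i s := inverse_point rad (vortex (zeta s) i) 0 0 in
  let y' i s := inverse_point rad (vortex (zeta s) i) 0 1 in
  let v1 s := velocity (zeta s) 0 0 in
  let v2 s := velocity (zeta s) 0 1 in
  [/\ forall i, derive1 (fun s => vortex (zeta s) i) t =
        - velocity (zeta t) + grad_regular_potential rad lam lams i (zeta t),
      derive1 (fun s => center (zeta s)) t = velocity (zeta t),
      a * derive1 v1 t =
        lam * v2 t - \sum_(i < n) lams i * (derive1 (y' i) t - derive1 (y i) t)
    & a * derive1 v2 t =
        - lam * v1 t
        + \sum_(i < n) lams i * (derive1 (x' i) t - derive1 (x i) t)].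

Definition hamiltonian_equations (R : realType) (N : nat)
    (H : 'rV[R]_N -> R) (J : 'rV[R]_N -> 'M[R]_N) (zeta : R -> 'rV[R]_N)
    (t : R) : Prop :=
  forall i, derive1 (fun s => zeta s 0 i) t =
    \sum_(k < N) J (zeta t) i k * partial k H (zeta t).

Definition jacobi_identity (R : realType) (N : nat) (D : set 'rV[R]_N)
    (J : 'rV[R]_N -> 'M[R]_N) : Prop :=
  forall z, D z -> forall i j k,
    \sum_(l < N) (J z i l * partial l (fun w => J w j k) z
                + J z k l * partial l (fun w => J w i j) z
                + J z j l * partial l (fun w => J w k i) z) = 0.

(* Main.v *)
From HB Require Import structures.
Require Import Defs.
From mathcomp Require Import all_boot all_order all_algebra.
From mathcomp Require Import all_classical all_reals all_analysis.
From mathcomp Require Import ring.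
Import Order.TTheory GRing.Theory Num.Theory.
Import numFieldNormedType.Exports.
Local Open Scope classical_set_scope.
Local Open Scope ring_scope.

(* Put pi_1 = a v_1 + \sum_i lams i (y~_i - y_i) and
   pi_2 = a v_2 - \sum_i lams i (x~_i - x_i).  The equations for v say that
   pi' = lam (v_2, - v_1), so (r_c, pi) behaves like a charge in a constant
   magnetic field and each r_i like a point vortex: in the coordinates
   (r_c, pi, r_1, ..., r_n) the Poisson brackets are the constants
   {x_c, pi_1} = {y_c, pi_2} = 1, {pi_1, pi_2} = lam, {x_i, y_i} = - 1 / lams i.
   The tensor J is the transform of this constant tensor to the variables zeta,
   and the Jacobi identity follows from the symmetry of second derivatives of
   the change of coordinates.  The Hamiltonian is
     a |v|^2 / 2 - 1/2 \sum_i lam lams_i ln |r_i|^2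
     + 1/4 \sum_(i, j) lams_i lams_j ln (R^4 - 2 R^2 (r_i, r_j) + |r_i|^2 |r_j|^2)
     - 1/4 \sum_(i != j) lams_i lams_j ln |r_i - r_j|^2. *)

Set Implicit Arguments.
Unset Strict Implicit.
Unset Printing Implicit Defensive.

(** * Reified functions *)

(* Functions on R^N are reified, so that smoothness and the symmetry of second
   derivatives follow by induction on the syntax. *)
Inductive expr (R : Type) (N : nat) : Type :=
| Cst of R
| Var of 'I_N
| Add of expr R N & expr R N
| Mul of expr R N & expr R N
| Inv of expr R N
| Ln of expr R N
| Atan of expr R N.
Arguments Cst {R N} _.
Arguments Var {R N} _.

Section Expr.
Context {R : realType} {N : nat}.
Implicit Types (e f : expr R N) (p v : 'rV[R]_N) (k l : 'I_N).

Fixpoint eval e p : R :=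
  match e with
  | Cst c => c
  | Var k => p 0 k
  | Add e f => eval e p + eval f p
  | Mul e f => eval e p * eval f p
  | Inv e => (eval e p)^-1
  | Ln e => ln (eval e p)
  | Atan e => atan (eval e p)
  end.

(** [eval] is total: inverses at 0 and logarithms outside the positive reals take default values.
    This predicate says that no default value is met in the evaluation. *)
Fixpoint defined_at p e : Prop :=
  match e with
  | Cst _ | Var _ => True
  | Add e f | Mul e f => defined_at p e /\ defined_at p f
  | Inv e => defined_at p e /\ eval e p != 0
  | Ln e => defined_at p e /\ 0 < eval e p
  | Atan e => defined_at p e
  end.

Fixpoint pd k e : expr R N :=
  match e with
  | Cst _ => Cst 0
  | Var l => Cst (l == k)%:R
  | Add e f => Add (pd k e) (pd k f)
  | Mul e f => Add (Mul (pd k e) f) (Mul e (pd k f))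
  | Inv e => Mul (Cst (-1)) (Mul (pd k e) (Mul (Inv e) (Inv e)))
  | Ln e => Mul (pd k e) (Inv e)
  | Atan e => Mul (pd k e) (Inv (Add (Cst 1) (Mul e e)))
  end.

(** The only new denominators are the argument of a logarithm, already positive, and [1 + e * e];
    hence derivatives of all orders stay defined. *)
Lemma pd_defined k p e : defined_at p e -> defined_at p (pd k e).
Proof.
elim: e => //= [e IHe f IHf|e IHe f IHf|e IHe|e IHe|e IHe].
- by case=> /IHe ? /IHf.
- by case=> de df; split; split; auto.
- by case=> de e0; repeat split; auto.
- by case=> de e0; repeat split; auto; rewrite gt_eqF.
- move=> de; repeat split; auto.
  by rewrite gt_eqF// ltr_pwDl// -expr2 sqr_ge0.
Qed.

Lemma diff_comp1 (g : R -> R) (f : 'rV[R]_N -> R) p (dg : R) :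
  differentiable f p -> is_derive (f p) 1 g dg ->
  differentiable (g \o f) p /\ forall v, 'd (g \o f) p v = 'd f p v * dg.
Proof.
move=> df [/derivable1_diffP dgf gE]; split; first exact: differentiable_comp.
move=> v; rewrite diff_comp// diff1E//= derive1E gE.
by rewrite mulrC [RHS]mulrC.
Qed.

(** Full differentiability, unlike mere existence of partial derivatives, survives composition, so
    the induction carries it along with the differential. *)
Lemma eval_diff e p : defined_at p e ->
  differentiable (eval e) p /\
  forall v, 'd (eval e) p v = \sum_k eval (pd k e) p * v 0 k.
Proof.
elim: e => [c|k|e IHe f IHf|e IHe f IHf|e IHe|e IHe|e IHe] /=.
- move=> _; split; first exact: differentiable_cst.
  by move=> v; rewrite diff_cst big1// => k _; rewrite mul0r.
- move=> _; split; first exact: differentiable_coord.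
  (* The coordinate is packed as a linear map, which is its own differential. *)
  move=> v; pose c (u : 'rV[R]_N) : R := u 0 k.
  have c_lin : linear c by move=> x u w; rewrite /c !mxE.
  pose cL : {linear 'rV[R]_N -> R} := HB.pack c (GRing.isLinear.Build _ _ _ _ _ c_lin).
  have -> : 'd (eval (Var k)) p v = v 0 k.
    by rewrite (_ : eval _ = cL)// diff_lin//; exact: coord_continuous.
  rewrite (bigD1 k)//= eqxx mul1r big1 ?addr0// => l lk.
  by rewrite eq_sym (negPf lk) mul0r.
- case=> /IHe[de dE] /IHf[df fE]; split; first exact: differentiableD.
  move=> v; rewrite (diffD de df) /= dE fE -big_split /=.
  by apply: eq_bigr => k _; rewrite mulrDl.
- case=> /IHe[de dE] /IHf[df fE]; split; first exact: differentiableM.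
  move=> v; have -> : 'd (eval (Mul e f)) p v =
      eval e p * 'd (eval f) p v + eval f p * 'd (eval e) p v.
    by rewrite (diffM de df).
  rewrite dE fE !mulr_sumr -big_split.
  by apply: eq_bigr => k _ /=; ring.
- case=> /IHe[de dE] e0; split; first exact: differentiableV.
  move=> v; have -> : 'd (eval (Inv e)) p v = - eval e p ^- 2 * 'd (eval e) p v.
    by rewrite diffV.
  rewrite dE mulr_sumr; apply: eq_bigr => k _ /=.
  by rewrite -exprVn; ring.
- case=> /IHe[de dE] e0.
  have [? lnE] := diff_comp1 de (is_derive1_ln e0); split => //.
  by move=> v; rewrite lnE dE mulr_suml; apply: eq_bigr => k _; ring.
- move=> /IHe[de dE].
  have [? lnE] := diff_comp1 de (is_derive1_atan (eval e p)); split => //.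
  by move=> v; rewrite lnE dE mulr_suml; apply: eq_bigr => k _; ring.
Qed.

Lemma eval_derivable e p v : defined_at p e -> derivable (eval e) p v.
Proof. by move=> /eval_diff[? _]; exact: diff_derivable. Qed.

Lemma partial_eval e p k : defined_at p e -> partial k (eval e) p = eval (pd k e) p.
Proof.
move=> /eval_diff[de dE]; rewrite /partial deriveE// dE (bigD1 k)//= mxE !eqxx mulr1.
by rewrite big1 ?addr0// => l lk; rewrite mxE eqxx (negPf lk) mulr0.
Qed.

Lemma grad_eval e p : defined_at p e -> grad (eval e) p = \row_k eval (pd k e) p.
Proof. by move=> de; apply/rowP => k; rewrite !mxE partial_eval. Qed.

(** Turns the time derivatives of inverse points in the equations for v into combinations of
    derivatives of the coordinates. *)
Lemma derive1_eval_curve e (c : R -> 'rV[R]_N) t :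
  derivable c t 1 -> defined_at (c t) e ->
  derive1 (fun s => eval e (c s)) t =
  \sum_k eval (pd k e) (c t) * derive1 (fun s => c s 0 k) t.
Proof.
move=> /derivable1_diffP dc /eval_diff[de dE].
have dec : differentiable (eval e \o c) t by exact: differentiable_comp.
rewrite derive1E deriveE//.
rewrite (_ : (fun s => eval e (c s)) = eval e \o c)// diff_comp//= dE.
apply: eq_bigr => k _; congr (_ * _).
have [dk kE] := eval_diff (e := Var k) (p := c t) I.
have dkc : differentiable (eval (Var k) \o c) t by exact: differentiable_comp.
rewrite derive1E deriveE//.
transitivity ('d (eval (Var k)) (c t) ('d c t 1)); last first.
  exact: esym (congr1 (fun g : R -> R => g 1) (diff_comp dc dk)).
rewrite kE.
rewrite (bigD1 k)//= eqxx mul1r big1 ?addr0// => l lk.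
by rewrite eq_sym (negPf lk) mul0r.
Qed.

(** Iterated partial derivatives are identified with formal ones on [D]; as [D] is open, they agree
    near each of its points, which transfers continuity and derivability. *)
Lemma smooth_eval (D : set 'rV[R]_N) e :
  open D -> (forall p, D p -> defined_at p e) -> smooth_on D (eval e).
Proof.
move=> oD De ks.
suff [f Df fE] : exists2 f, forall p, D p -> defined_at p f
    & forall p, D p -> iter_partial ks (eval e) p = eval f p.
  move=> p Dp.
  have near_eq : {near p, eval f =1 iter_partial ks (eval e)}.
    by near=> q; apply/esym/fE; near: q; exact: open_nbhs_nbhs.
  have [df _] := eval_diff (Df _ Dp); split.
    rewrite /prop_for /continuous_at fE//; apply: cvg_trans (differentiable_continuous df).
    exact: (near_eq_cvg (F := nbhs p)) near_eq.
  move=> k; apply: (@near_eq_derivable _ _ _ (eval f)); first exact: near_eq.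
  exact: eval_derivable (Df _ Dp).
elim: ks => [|k ks [f Df fE]] /=; first by exists e.
exists (pd k f) => p Dp; first exact: pd_defined (Df _ Dp).
rewrite -(partial_eval _ (Df _ Dp)); apply: near_eq_derive.
by near=> q; apply/fE; near: q; exact: open_nbhs_nbhs.
Unshelve. all: by end_near. Qed.

(** A ring identity in the values of subexpressions and their inverses; it plays the role of
    Schwarz's theorem. *)
Lemma pdC k l e p : eval (pd k (pd l e)) p = eval (pd l (pd k e)) p.
Proof.
elim: e => //= [e IHe f IHf|e IHe f IHf|e IHe|e IHe|e IHe];
  rewrite ?IHe ?IHf //; ring.
Qed.

(** The constructor [Add] obeys no monoid law, but [big_morph] and [big_ind] ask for none. *)
Definition Sum (I : finType) (P : pred I) (F : I -> expr R N) : expr R N :=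
  \big[(@Add R N)/Cst 0]_(i | P i) F i.

Lemma eval_Sum (I : finType) (P : pred I) F p :
  eval (@Sum I P F) p = \sum_(i | P i) eval (F i) p.
Proof. exact: (big_morph (eval^~ p)). Qed.

Lemma pd_Sum (I : finType) (P : pred I) F k :
  pd k (@Sum I P F) = Sum P (fun i => pd k (F i)).
Proof. exact: (big_morph (pd k)). Qed.

Lemma defined_Sum (I : finType) (P : pred I) F p :
  (forall i, P i -> defined_at p (F i)) -> defined_at p (@Sum I P F).
Proof. by move=> dF; apply: big_ind. Qed.

(** A syntactic sufficient condition for a vanishing partial derivative. It is stable under [pd], so
    it also serves for second derivatives. *)
Fixpoint indep k e : bool :=
  match e with
  | Cst _ => true
  | Var l => l != k
  | Add e f | Mul e f => indep k e && indep k f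
  | Inv e | Ln e | Atan e => indep k e
  end.

Lemma eval_pd_indep k e p : indep k e -> eval (pd k e) p = 0.
Proof.
elim: e => //= [l /negPf ->//|e IHe f IHf|e IHe f IHf|e IHe|e IHe|e IHe].
- by case/andP => /IHe -> /IHf ->; rewrite addr0.
- by case/andP => /IHe -> /IHf ->; rewrite mul0r mulr0 addr0.
- by move=> /IHe ->; rewrite !(mul0r, mulr0).
- by move=> /IHe ->; rewrite !(mul0r, mulr0).
- by move=> /IHe ->; rewrite !(mul0r, mulr0).
Qed.

Lemma indep_pd k l e : indep k e -> indep k (pd l e).
Proof.
elim: e => //= [e IHe f IHf|e IHe f IHf|e IHe|e IHe|e IHe].
- by case/andP => /IHe -> /IHf ->.
- by case/andP => ke kf; rewrite ke kf IHe ?IHf.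
- by move=> ke; rewrite ke IHe.
- by move=> ke; rewrite ke IHe.
- by move=> ke; rewrite ke IHe.
Qed.

Lemma indep_Sum (I : finType) (P : pred I) F k :
  (forall i, P i -> indep k (F i)) -> indep k (@Sum I P F).
Proof. by move=> dF; apply: (big_ind (indep k)) => //= ? ? -> ->. Qed.

End Expr.

(** * Transforming a constant Poisson tensor *)

Section Pushforward.
Context {R : realType} {N : nat}.
Variables (Om : 'I_N -> 'I_N -> R) (G : 'I_N -> expr R N).
Hypothesis Om_anti : forall b c, Om b c = - Om c b.

(* If G expresses coordinates zeta through coordinates with constant brackets
   Om, then bracket i j is the bracket of zeta_i and zeta_j. *)
Definition bracket (i j : 'I_N) : expr R N :=
  Sum predT (fun b => Sum predT (fun c =>
    Mul (Cst (Om b c)) (Mul (pd b (G i)) (pd c (G j))))).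

Definition poisson_tensor (p : 'rV[R]_N) : 'M[R]_N :=
  \matrix_(i, j) eval (bracket i j) p.

Lemma bracket_defined p i j : (forall k, defined_at p (G k)) ->
  defined_at p (bracket i j).
Proof.
move=> dG; do 2![apply: defined_Sum => ? _].
by do ?split => //; exact: pd_defined.
Qed.

Lemma poisson_tensorE p i j : poisson_tensor p i j =
  \sum_b \sum_c Om b c * (eval (pd b (G i)) p * eval (pd c (G j)) p).
Proof.
rewrite mxE eval_Sum; apply: eq_bigr => b _.
by rewrite eval_Sum; apply: eq_bigr.
Qed.

Lemma poisson_tensor_anti p i j : poisson_tensor p i j = - poisson_tensor p j i.
Proof.
rewrite !poisson_tensorE exchange_big -sumrN /=; apply: eq_bigr => b _.
by rewrite -sumrN; apply: eq_bigr => c _; rewrite Om_anti; ring.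
Qed.

(** For zeta = G(w), the second hypothesis is the chain rule for the derivative of G_j along w_c,
    read as a function of zeta. It holds when this derivative involves only coordinates shared by
    zeta and w. *)
Lemma poisson_tensor_jacobi (D : set 'rV[R]_N) :
  (forall p, D p -> forall k, defined_at p (G k)) ->
  (forall p, D p -> forall b c j,
    \sum_l eval (pd b (G l)) p * eval (pd l (pd c (G j))) p =
    eval (pd b (pd c (G j))) p) ->
  jacobi_identity D poisson_tensor.
Proof.
move=> dG GG p Dp i j k.
(* The chain rule GG reduces the cyclic sum to one of terms U, which cancel in
   pairs by the symmetry of the second derivatives h of G. *)
pose A i b := eval (pd b (G i)) p.
pose h b c j := eval (pd b (pd c (G j))) p.
pose P i c := \sum_b Om b c * A i b.
pose U i j k := \sum_b \sum_c P i b * P k c * h b c j.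
have PN i' c : \sum_b Om c b * A i' b = - P i' c.
  by rewrite -sumrN; apply: eq_bigr => b _; rewrite Om_anti mulNr.
have U_sym i' j' k' : U i' j' k' = U k' j' i'.
  rewrite /U exchange_big /=; apply: eq_bigr => b _; apply: eq_bigr => c _.
  by rewrite /h pdC; ring.
have JE i' l : poisson_tensor p i' l = \sum_c P i' c * A l c.
  rewrite poisson_tensorE exchange_big; apply: eq_bigr => c _ /=.
  by rewrite mulr_suml; apply: eq_bigr => b _; rewrite mulrA.
have dJ l j' k' : partial l (fun w => poisson_tensor w j' k') p =
    \sum_c (P j' c * h l c k' - P k' c * h l c j').
  have -> : (fun w => poisson_tensor w j' k') = eval (bracket j' k').
    by apply: funext => w; rewrite mxE.
  rewrite partial_eval; last exact/bracket_defined/dG.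
  rewrite pd_Sum eval_Sum.
  (* Product rule. The first term contracts the second index of [Om], whence the minus sign in front
     of [P k']. *)
  transitivity (\sum_b \sum_c (Om b c * A k' c * h l b j' + Om b c * A j' b * h l c k')).
    apply: eq_bigr => b _; rewrite pd_Sum eval_Sum; apply: eq_bigr => c _ /=.
    by rewrite /h /A; ring.
  rewrite sumrB [RHS]addrC.
  under eq_bigr do rewrite big_split; rewrite big_split /=; congr (_ + _).
    rewrite -sumrN; apply: eq_bigr => c _.
    by rewrite -mulr_suml PN mulNr.
  rewrite exchange_big; apply: eq_bigr => c _ /=.
  by rewrite -mulr_suml.
have X i' j' k' : \sum_l poisson_tensor p i' l *
    partial l (fun w => poisson_tensor w j' k') p = U i' k' j' - U i' j' k'.
  transitivity (\sum_l \sum_b \sum_c P i' b *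
     (P j' c * (A l b * h l c k') - P k' c * (A l b * h l c j'))).
    apply: eq_bigr => l _; rewrite JE dJ mulr_suml; apply: eq_bigr => b _.
    by rewrite mulr_sumr; apply: eq_bigr => c _; ring.
  rewrite exchange_big -sumrB; apply: eq_bigr => b _.
  rewrite exchange_big -sumrB; apply: eq_bigr => c _ /=.
  by rewrite -mulr_sumr sumrB -!mulr_sumr !GG//; rewrite /h; ring.
rewrite !big_split /= !X (U_sym k i j) (U_sym k j i) (U_sym j k i); ring.
Qed.

End Pushforward.

(** * Coordinates of the phase space *)

Lemma sum_ord2 (V : nmodType) (F : 'I_2 -> V) : \sum_k F k = F 0 + F 1.
Proof.
by rewrite big_ord_recl big_ord1; congr (_ + F _); apply: val_inj.
Qed.

Lemma forall_ord2 (P : 'I_2 -> Prop) : P 0 -> P 1 -> forall k, P k.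
Proof.
move=> P0 P1 [[|[|//]] k_lt].
  by rewrite (_ : Ordinal _ = 0)//; exact: val_inj.
by rewrite (_ : Ordinal _ = 1)//; exact: val_inj.
Qed.

Lemma sum_delta (R : pzRingType) (I : finType) (i : I) (F : I -> R) :
  \sum_j (j == i)%:R * F j = F i.
Proof.
rewrite (bigD1 i)//= eqxx mul1r big1 ?addr0// => j /negPf ->.
by rewrite mul0r.
Qed.

(* The matrix [[0, 1], [-1, 0]]. *)
Definition symp (R : pzRingType) (k l : 'I_2) : R := (l : nat)%:R - (k : nat)%:R.

Lemma symp_anti (R : pzRingType) k l : symp R k l = - symp R l k.
Proof. by rewrite /symp opprB. Qed.

Lemma sum_symp (R : pzRingType) (F : 'I_2 -> R) (k : 'I_2) :
  \sum_l symp R k l * F l = if k == 0 then F 1 else - F 0.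
Proof.
rewrite sum_ord2 /symp; move: k; apply: forall_ord2 => /=.
  by rewrite subrr mul0r add0r subr0 mul1r.
by rewrite subrr mul0r addr0 sub0r mulN1r.
Qed.

Definition sqn (R : pzRingType) (u : 'I_2 -> R) : R := u 0 ^+ 2 + u 1 ^+ 2.

(** * Expressions for plane vectors and for branches of the argument *)

Section PlaneVectors.
Context {R : realType} {N : nat}.
Implicit Types (u w : 'I_2 -> expr R N) (p : 'rV[R]_N).

Definition dotE u w := Add (Mul (u 0) (w 0)) (Mul (u 1) (w 1)).

Definition subE u w (k : 'I_2) := Add (u k) (Mul (Cst (-1)) (w k)).

(** Equal to |w|^2 times the squared distance from u to the inverse point of w, but polynomial and
    symmetric in u and w. *)
Definition imageE (rad : R) u w :=
  Add (Cst (rad ^+ 4))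
    (Add (Mul (Cst (- 2 * rad ^+ 2)) (dotE u w)) (Mul (dotE u u) (dotE w w))).

(* b tells which of the two formulas of arctan_branch applies. *)
Definition argE (b : bool) u :=
  if b then Atan (Mul (u 1) (Inv (u 0)))
  else Add (Cst (pi / 2)) (Mul (Cst (-1)) (Atan (Mul (u 0) (Inv (u 1))))).

Lemma eval_dotE u p : eval (dotE u u) p = sqn (fun k => eval (u k) p).
Proof. by rewrite /sqn 2!expr2. Qed.

Lemma argE_defined u p : (forall k, defined_at p (u k)) ->
  sqn (fun k => eval (u k) p) != 0 ->
  defined_at p (argE (eval (u 0) p != 0) u).
Proof.
rewrite /sqn /argE => du u0; case: ifPn => /= [//|/negPn/eqP u00]; repeat split => //.
by move: u0; rewrite u00 expr0n/= add0r expf_eq0.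
Qed.

(** Both branches have the same gradient, so the choice of branch disappears here. *)
Lemma pd_argE u p k : sqn (fun k => eval (u k) p) != 0 ->
  eval (pd k (argE (eval (u 0) p != 0) u)) p =
  (eval (u 0) p * eval (pd k (u 1)) p - eval (u 1) p * eval (pd k (u 0)) p)
  / sqn (fun k => eval (u k) p).
Proof.
rewrite /sqn /argE => u0; case: ifPn => /= [u00|/negPn/eqP u00]; field; rewrite u0//=.
by move: u0; rewrite u00 expr0n/= add0r expf_eq0.
Qed.

End PlaneVectors.

Section Coordinates.
Context {n : nat}.

Definition coord : finType := ('I_2 + 'I_2 + 'I_n * 'I_2)%type.

(** Follows the block layout of the phase vector; [mxvec_index] matches the row-major [vec_mx] used
    in [vortex]. *)
Definition enc (c : coord) : 'I_(2 + 2 + n * 2) :=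
  match c with
  | inl (inl k) => lshift (n * 2) (lshift 2 k)
  | inl (inr k) => lshift (n * 2) (rshift 2 k)
  | inr ik => rshift (2 + 2) (mxvec_index ik.1 ik.2)
  end.

Definition dec (b : 'I_(2 + 2 + n * 2)) : coord :=
  match fintype.split b with
  | inl b => inl (fintype.split b)
  | inr b => inr (enum_val (cast_ord (esym (mxvec_cast n 2)) b))
  end.

Lemma encK : cancel enc dec.
Proof.
case=> [[k|k]|[i k]]; rewrite /enc /dec.
- by rewrite (unsplitK (inl _)) (unsplitK (inl _)).
- by rewrite (unsplitK (inl _)) (unsplitK (inr _)).
- by rewrite (unsplitK (inr _)) cast_ordK enum_rankK.
Qed.

Lemma decK : cancel dec enc.
Proof.
move=> b; rewrite -[RHS]splitK /dec; case: (fintype.split b) => {}b /=.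
  by rewrite -[RHS]/(lshift _ b) -[in RHS](splitK b); case: (fintype.split b).
case: (mxvec_indexP b) => i k; rewrite cast_ordK enum_rankK //.
Qed.

Lemma enc_eq c d : (enc c == enc d) = (c == d).
Proof. exact: (can_eq encK). Qed.

Lemma sum_enc (V : nmodType) (F : 'I_(2 + 2 + n * 2) -> V) :
  \sum_b F b = \sum_k F (enc (inl (inl k))) + \sum_k F (enc (inl (inr k)))
    + \sum_i \sum_k F (enc (inr (i, k))).
Proof.
rewrite (reindex enc) /=; last by exists dec => ? _; rewrite ?encK ?decK.
rewrite !big_sumType /=; congr (_ + _).
by rewrite pair_bigA; apply: eq_bigr => -[].
Qed.

End Coordinates.
Arguments coord n : clear implicits.
Arguments enc : simpl never.

Notation Ic k := (enc (inl (inl k))).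
Notation Iv k := (enc (inl (inr k))).
Notation Ir i k := (enc (inr (i, k))).

Lemma enorm_sqr (R : realType) (u : 'rV[R]_2) : enorm u ^+ 2 = sqn (u 0).
Proof.
rewrite /enorm /dotp sum_ord2 -!expr2 sqr_sqrtr//.
by rewrite addr_ge0 ?sqr_ge0.
Qed.

Lemma enorm_gt (R : realType) (rad : R) (u : 'rV[R]_2) : 0 < rad ->
  (rad < enorm u) = (rad ^+ 2 < sqn (u 0)).
Proof.
move=> rad_gt0; rewrite -enorm_sqr ltr_pXn2r// nnegrE ?(ltW rad_gt0)//.
exact: sqrtr_ge0.
Qed.

Lemma sqn_eq0 (R : realDomainType) (u : 'I_2 -> R) :
  (sqn u == 0) = (u 0 == 0) && (u 1 == 0).
Proof. by rewrite paddr_eq0 ?sqr_ge0// !sqrf_eq0. Qed.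

Lemma sqn_ge0 (R : realDomainType) (u : 'I_2 -> R) : 0 <= sqn u.
Proof. by rewrite addr_ge0 ?sqr_ge0. Qed.

Lemma row2_neq (R : realDomainType) (u w : 'rV[R]_2) :
  (u != w) = (0 < sqn (fun k => u 0 k - w 0 k)).
Proof.
rewrite lt0r sqn_ge0 andbT sqn_eq0 !subr_eq0; congr (~~ _).
apply/eqP/andP => [->//|[/eqP u0 /eqP u1]].
by apply/rowP; apply: forall_ord2.
Qed.

(* |w|^2 times the squared distance from u to the point inverse to w. *)
Definition image_dist (R : pzRingType) (rad : R) (u w : 'I_2 -> R) : R :=
  rad ^+ 4 + (- 2 * rad ^+ 2 * (u 0 * w 0 + u 1 * w 1) + sqn u * sqn w).

Lemma image_dist_sym (R : comPzRingType) (rad : R) u w :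
  image_dist rad u w = image_dist rad w u.
Proof. by rewrite /image_dist; ring. Qed.

(** It is the sum of the squares of rad^2 - (u, w) and of the cross product. If both vanished,
    Lagrange's identity would give |u|^2 |w|^2 = rad^4, which is too small outside the disk. *)
Lemma image_dist_gt0 (R : realDomainType) (rad : R) (u w : 'I_2 -> R) :
  0 < rad -> rad ^+ 2 < sqn u -> rad ^+ 2 < sqn w -> 0 < image_dist rad u w.
Proof.
move=> rad0 ru rw.
have -> : image_dist rad u w =
   (rad ^+ 2 - (u 0 * w 0 + u 1 * w 1)) ^+ 2 + (u 0 * w 1 - u 1 * w 0) ^+ 2.
  by rewrite /image_dist /sqn; ring.
rewrite lt0r addr_ge0 ?sqr_ge0// andbT paddr_eq0 ?sqr_ge0// !sqrf_eq0.
apply/negP => /andP[/eqP dot_eq /eqP cross_eq].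
have : sqn u * sqn w = rad ^+ 2 * rad ^+ 2.
  have -> : sqn u * sqn w =
    (u 0 * w 0 + u 1 * w 1) ^+ 2 + (u 0 * w 1 - u 1 * w 0) ^+ 2.
    by rewrite /sqn; ring.
  rewrite cross_eq; move/eqP: dot_eq; rewrite subr_eq0 => /eqP <-; ring.
have : rad ^+ 2 * rad ^+ 2 < sqn u * sqn w.
  by rewrite ltr_pM// ltW// exprn_gt0.
by move=> /[swap] ->; rewrite ltxx.
Qed.

(** * The canonical brackets, the change of variables and the Hamiltonian *)

Section CylinderVortices.
Context {R : realType} {n : nat}.
Variables (rad a lam : R) (lams : 'I_n -> R).
Notation N := (2 + 2 + n * 2)%N.
Implicit Types (z : phase R n) (i j : 'I_n) (k l m : 'I_2).

Lemma centerE z k : Defs.center z 0 k = z 0 (Ic k).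
Proof. by rewrite !mxE. Qed.

Lemma velocityE z k : velocity z 0 k = z 0 (Iv k).
Proof. by rewrite !mxE. Qed.

Lemma vortexE z i k : vortex z i 0 k = z 0 (Ir i k).
Proof. by rewrite !mxE. Qed.

Definition velE k : expr R N := Var (Iv k).
Definition posE i k : expr R N := Var (Ir i k).
Definition invE i k : expr R N :=
  Mul (Cst (rad ^+ 2)) (Mul (posE i k) (Inv (dotE (posE i) (posE i)))).

(* With pi_k = a v_k + \sum_i lams i * \sum_l symp k l * (inverse point - vortex)_il,
   the brackets of the coordinates (r_c, pi, r_1, ..., r_n); inl (inr k) stands
   for pi_k. *)
Definition canonical_om (b c : coord n) : R :=
  match b, c with
  | inl (inl k), inl (inr l) => (k == l)%:R
  | inl (inr k), inl (inl l) => - (k == l)%:R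
  | inl (inr k), inl (inr l) => lam * symp R k l
  | inr (i, k), inr (j, l) => - ((i == j)%:R / lams i * symp R k l)
  | _, _ => 0
  end.

Definition omega (b c : 'I_N) : R := canonical_om (dec b) (dec c).

(* zeta as a function of (r_c, pi, r_1, ..., r_n).  Its derivatives involve
   only the r_i, which belong to both coordinate systems, and so they may be
   evaluated at zeta itself. *)
Definition liftE (b : 'I_N) : expr R N :=
  match dec b with
  | inl (inr k) => Mul (Cst a^-1) (Add (velE k) (Mul (Cst (-1))
      (Sum predT (fun i => Mul (Cst (lams i))
        (Sum predT (fun l => Mul (Cst (symp R k l)) (subE (invE i) (posE i) l)))))))
  | _ => Var b
  end.

(* As imageE u u = (|u|^2 - rad^2)^2, the terms i = j of the double sum over all i, j are
   the interactions lams i ^ 2 / 2 * ln (|r_i|^2 - rad^2) of a vortex with its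
   own image. *)
Definition hamE : expr R N :=
  Add (Mul (Cst (a / 2)) (dotE velE velE))
  (Add (Sum predT (fun i =>
          Mul (Cst (- (lam * lams i) / 2)) (Ln (dotE (posE i) (posE i)))))
  (Add (Sum predT (fun i => Sum predT (fun j =>
          Mul (Cst (lams i * lams j / 4)) (Ln (imageE rad (posE i) (posE j))))))
       (Sum predT (fun i => Sum (predC1 i) (fun j =>
          Mul (Cst (- (lams i * lams j) / 4))
            (Ln (dotE (subE (posE i) (posE j)) (subE (posE i) (posE j))))))))).

Lemma omega_anti b c : omega b c = - omega c b.
Proof.
rewrite /omega /canonical_om.
case: (dec b) => [[k|k]|[i k]]; case: (dec c) => [[l|l]|[j l]];
  rewrite ?oppr0 ?opprK //.
- by rewrite eq_sym.
- by rewrite eq_sym.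
- by rewrite symp_anti mulrN.
- by rewrite (symp_anti R k) mulrN opprK eq_sym; case: eqP => [->|]; rewrite ?mul0r ?oppr0.
Qed.

Section OnPhaseSpace.
Hypothesis rad_gt0 : 0 < rad.

(** Membership becomes positivity of finitely many expressions, an open condition. *)
Lemma phase_spaceP z : phase_space rad z <->
  (forall i, 0 < eval (Add (dotE (posE i) (posE i)) (Cst (- rad ^+ 2))) z) /\
  (forall i j, j != i ->
    0 < eval (dotE (subE (posE i) (posE j)) (subE (posE i) (posE j))) z).
Proof.
have rE i : (rad < enorm (vortex z i)) =
    (0 < eval (Add (dotE (posE i) (posE i)) (Cst (- rad ^+ 2))) z).
  by rewrite enorm_gt// -subr_gt0 /sqn !vortexE /= !expr2.
have dE i j : (vortex z i != vortex z j) =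
    (0 < eval (dotE (subE (posE i) (posE j)) (subE (posE i) (posE j))) z).
  by rewrite row2_neq /sqn !vortexE /= !mulN1r !expr2.
split=> -[zr zd]; split=> [i|i j ij].
- by rewrite -rE.
- by rewrite -dE zd// eq_sym.
- by rewrite rE.
- by rewrite dE zd// eq_sym.
Qed.

Lemma open_phase_space : open (@phase_space R n rad).
Proof.
have pos_near e z : defined_at z e -> 0 < eval e z -> \forall w \near z, 0 < eval e w.
  move=> /eval_diff[de _] ez.
  exact: cvgr_gt (differentiable_continuous de) _ ez.
rewrite openE => z /phase_spaceP[zr zd].
have nr : \forall w \near z, forall i,
    0 < eval (Add (dotE (posE i) (posE i)) (Cst (- rad ^+ 2))) w.
  apply: (@filter_forall _ _ _ (nbhs z)) => i.
  by apply: pos_near => //; do ?split.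
have nd : \forall w \near z, forall i j, j != i ->
    0 < eval (dotE (subE (posE i) (posE j)) (subE (posE i) (posE j))) w.
  apply: (@filter_forall _ _ _ (nbhs z)) => i.
  apply: (@filter_forall _ _ _ (nbhs z)) => j.
  have [->|ij] := eqVneq j i; first by near=> w.
  near=> w => _; near: w; apply: pos_near (zd i j ij).
  by do ?split.
by near=> w; apply/phase_spaceP; split; near: w.
Unshelve. all: by end_near. Qed.

Variable z : phase R n.
Hypothesis zP : phase_space rad z.

Lemma sqn_vortex i : rad ^+ 2 < sqn (vortex z i 0).
Proof. by rewrite -enorm_gt//; case: zP. Qed.

Lemma sqn_vortex_neq0 i : sqn (vortex z i 0) != 0.
Proof. by rewrite gt_eqF// (lt_trans _ (sqn_vortex i))// exprn_gt0. Qed.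

Lemma eval_sqn i : eval (dotE (posE i) (posE i)) z = sqn (vortex z i 0).
Proof. by rewrite eval_dotE /sqn !vortexE. Qed.

Lemma invE_defined i k : defined_at z (invE i k).
Proof.
split=> //; split=> //; split; first by do ?split.
by rewrite eval_sqn sqn_vortex_neq0.
Qed.

Lemma liftE_defined b : defined_at z (liftE b).
Proof.
rewrite /liftE; case: (dec b) => [[k|k]|ik] //.
split=> //; split=> //; split=> //; apply: defined_Sum => i _; split=> //.
apply: defined_Sum => l _; split=> //; split; last by [].
exact: invE_defined.
Qed.

Lemma eval_imageE i j : eval (imageE rad (posE i) (posE j)) z =
  image_dist rad (vortex z i 0) (vortex z j 0).
Proof. by rewrite /image_dist /sqn !vortexE /= !expr2. Qed.

Lemma imageE_gt0 i j : 0 < eval (imageE rad (posE i) (posE j)) z.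
Proof. by rewrite eval_imageE image_dist_gt0// sqn_vortex. Qed.

Lemma hamE_defined : defined_at z hamE.
Proof.
have [_ zd] := (phase_spaceP z).1 zP.
split=> //; split; last split.
- apply: defined_Sum => i _; split=> //; split=> //.
  by rewrite eval_sqn lt0r sqn_vortex_neq0 sqn_ge0.
- apply: defined_Sum => i _; apply: defined_Sum => j _; split=> //; split=> //.
  exact: imageE_gt0.
- apply: defined_Sum => i _; apply: defined_Sum => j ij; split=> //; split; last exact: zd.
  by do ?split.
Qed.

End OnPhaseSpace.
End CylinderVortices.

(** * The gradient of the velocity potential *)

Section Potential.
Context {R : realType} {n : nat}.
Variables (rad lam : R) (lams : 'I_n -> R).
Implicit Types (z : phase R n) (i j : 'I_n) (k l m : 'I_2) (p q : 'rV[R]_2).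

Definition displE q : 'I_2 -> expr R 2 := subE Var (fun k => Cst (q 0 k)).

(** The test is made at [p0] when the expression is built, so a single smooth formula is
    differentiated. *)
Definition arg_atE p0 q : expr R 2 := argE (eval (displE q 0) p0 != 0) (displE q).

Lemma arctan_branchE p0 q p :
  arctan_branch (p0 - q) (p - q) = eval (arg_atE p0 q) p.
Proof.
rewrite /arctan_branch /arg_atE /argE /= !mxE !mulN1r.
by case: ifP => _ //=; rewrite !mulN1r.
Qed.

Lemma eval_displE q p : (fun k => eval (displE q k) p) = (fun k => p 0 k - q 0 k).
Proof. by apply: funext => k /=; rewrite mulN1r. Qed.

(** Up to strength, the field of a point vortex at q: the displacement turned by a right angle, over
    its squared length. *)
Lemma pd_arg_atE p q k : p != q ->
  eval (pd k (arg_atE p q)) p =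
  - (\sum_l symp R k l * (p 0 l - q 0 l)) / sqn (fun k => p 0 k - q 0 k).
Proof.
rewrite row2_neq => pq.
rewrite pd_argE eval_displE ?gt_eqF//; congr (_ / _).
by rewrite sum_symp /=; move: k; apply: forall_ord2 => /=; ring.
Qed.

Lemma arg_atE_defined p q : p != q -> defined_at p (arg_atE p q).
Proof.
rewrite row2_neq => pq; apply: argE_defined; first by move=> k /=.
by rewrite eval_displE gt_eqF.
Qed.

Definition potE z (P : pred 'I_n) p0 : expr R 2 :=
  Add (Mul (Mul (Cst (- rad ^+ 2)) (Inv (dotE Var Var)))
           (dotE Var (fun k => Cst (velocity z 0 k))))
  (Add (Mul (Cst (- lam)) (arg_atE p0 0))
  (Add (Sum predT (fun j =>
          Mul (Cst (lams j)) (arg_atE p0 (inverse_point rad (vortex z j)))))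
       (Mul (Cst (-1)) (Sum P (fun j =>
          Mul (Cst (lams j)) (arg_atE p0 (vortex z j))))))).

Lemma potentialE z P p0 p :
  potential rad lam lams P z p0 p = eval (potE z P p0) p.
Proof.
(* Subtracting 0 makes the circulation term a vortex term located at the center. *)
rewrite /potential -[p in arctan_branch p0 p]subr0 -[p0 in arctan_branch p0 _]subr0.
rewrite arctan_branchE [RHS]/= !eval_Sum enorm_sqr /sqn /dotp sum_ord2 !expr2.
rewrite !mulN1r -!addrA; congr (_ + (_ + (_ - _))).
- by rewrite !mulNr.
- by rewrite !mulNr.
- by apply: eq_bigr => j _; rewrite arctan_branchE.
- by apply: eq_bigr => j _; rewrite arctan_branchE.
Qed.

Lemma pd_arg_sum (P : pred 'I_n) (q : 'I_n -> 'rV[R]_2) p k :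
  (forall j, P j -> p != q j) ->
  eval (pd k (Sum P (fun j => Mul (Cst (lams j)) (arg_atE p (q j))))) p =
  - \sum_l symp R k l * \sum_(j | P j)
      lams j * ((p 0 l - q j 0 l) / sqn (fun k => p 0 k - q j 0 k)).
Proof.
move=> pq; rewrite pd_Sum eval_Sum -sumrN.
under [RHS]eq_bigr do rewrite mulr_sumr -sumrN.
rewrite exchange_big; apply: eq_bigr => j Pj /=.
rewrite pd_arg_atE ?pq// mul0r add0r mulNr mulrN mulr_suml mulr_sumr -sumrN.
by apply: eq_bigr => l _; ring.
Qed.

Hypothesis rad_gt0 : 0 < rad.
Variable z : phase R n.
Hypothesis zP : phase_space rad z.
Notation r := (fun i => vortex z i 0).
Notation v := (velocity z 0).

Lemma image_dist_neq0 i j : image_dist rad (r i) (r j) != 0.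
Proof. by rewrite gt_eqF// image_dist_gt0//; apply: sqn_vortex. Qed.

Lemma inverse_pointE i k :
  inverse_point rad (vortex z i) 0 k = rad ^+ 2 / sqn (r i) * r i k.
Proof. by rewrite !mxE enorm_sqr. Qed.

(** Replaces distances to inverse points by the symmetric [image_dist], whose logarithm enters the
    Hamiltonian. *)
Lemma sqn_inverse i j :
  sqn (fun k => r i k - inverse_point rad (vortex z j) 0 k) =
  image_dist rad (r i) (r j) / sqn (r j).
Proof.
have := sqn_vortex_neq0 rad_gt0 zP j.
rewrite /sqn !inverse_pointE /image_dist /sqn => rj; field.
exact: rj.
Qed.

Lemma vortex_neq_inverse i j : vortex z i != inverse_point rad (vortex z j).
Proof.
rewrite row2_neq sqn_inverse divr_gt0//; first by rewrite image_dist_gt0//; apply: sqn_vortex.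
by rewrite lt0r sqn_ge0 (sqn_vortex_neq0 rad_gt0 zP).
Qed.

Lemma vortex_neq0 i : vortex z i != 0.
Proof.
apply/eqP => r0; have := sqn_vortex rad_gt0 zP i.
by rewrite r0 /sqn !mxE expr0n addr0 ltNge sqr_ge0.
Qed.

(** The image terms are cleared of the denominator |r_j|^2 so that the factor after [symp] is
    exactly - 1 / lams i times the derivative [dham] of the Hamiltonian. *)
Lemma grad_regular_potentialE i k :
  grad_regular_potential rad lam lams i z 0 k =
  - rad ^+ 2 * (v k / sqn (r i)
     - 2 * r i k * (r i 0 * v 0 + r i 1 * v 1) / sqn (r i) ^+ 2)
  + \sum_l symp R k l *
      (lam * r i l / sqn (r i)
       - \sum_j lams j * ((sqn (r j) * r i l - rad ^+ 2 * r j l) / image_dist rad (r i) (r j))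
       + \sum_(j | j != i) lams j * ((r i l - r j l) / sqn (fun k => r i k - r j k))).
Proof.
rewrite /grad_regular_potential.
rewrite (_ : potential _ _ _ _ _ _ = eval (potE z (predC1 i) (vortex z i))); last first.
  by apply: funext => p; rewrite potentialE.
have ri0 := sqn_vortex_neq0 rad_gt0 zP i.
rewrite grad_eval; last first.
  split; first by do ?split=> //; rewrite eval_dotE.
  split; first by split => //; apply: arg_atE_defined; exact: vortex_neq0.
  split; first by apply: defined_Sum => j _; split=> //;
    apply: arg_atE_defined; exact: vortex_neq_inverse.
  split=> //; apply: defined_Sum => j ij; split=> //; apply: arg_atE_defined.
  by rewrite eq_sym; apply: zP.2.
have inv_term l : \sum_j lams j * ((r i l - inverse_point rad (vortex z j) 0 l) /
      sqn (fun k => r i k - inverse_point rad (vortex z j) 0 k)) =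
    \sum_j lams j * ((sqn (r j) * r i l - rad ^+ 2 * r j l) / image_dist rad (r i) (r j)).
  apply: eq_bigr => j _; rewrite sqn_inverse inverse_pointE.
  by field; rewrite image_dist_neq0 (sqn_vortex_neq0 rad_gt0 zP).
have pot_term : eval (pd k (Mul (Mul (Cst (- rad ^+ 2)) (Inv (dotE Var Var)))
      (dotE Var (fun k => Cst (v k))))) (vortex z i) =
    - rad ^+ 2 * (v k / sqn (r i)
     - 2 * r i k * (r i 0 * v 0 + r i 1 * v 1) / sqn (r i) ^+ 2).
  move: ri0; rewrite /sqn /=; move: k; apply: forall_ord2 => /= ri0; field; exact: ri0.
rewrite mxE /potE.
transitivity (eval (pd k (Mul (Mul (Cst (- rad ^+ 2)) (Inv (dotE Var Var)))
      (dotE Var (fun k => Cst (v k))))) (vortex z i)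
  + (- lam * eval (pd k (arg_atE (vortex z i) 0)) (vortex z i)
  + (eval (pd k (Sum predT (fun j =>
          Mul (Cst (lams j)) (arg_atE (vortex z i) (inverse_point rad (vortex z j)))))) (vortex z i)
  - eval (pd k (Sum (predC1 i) (fun j =>
          Mul (Cst (lams j)) (arg_atE (vortex z i) (vortex z j))))) (vortex z i)))).
  by rewrite /=; ring.
rewrite pot_term pd_arg_atE ?vortex_neq0//.
rewrite pd_arg_sum; last by move=> j _; exact: vortex_neq_inverse.
rewrite pd_arg_sum; last by move=> j ij; rewrite eq_sym; exact: zP.2.
congr (_ + _).
rewrite mulrA mulrNN opprK mulr_sumr mulr_suml -sumrN -!big_split /=.
apply: eq_bigr => l _; rewrite inv_term.
rewrite (_ : sqn (fun k => r i k - (0 : 'rV[R]_2) 0 k) = sqn (r i)); last first.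
  by rewrite /sqn !mxE !subr0.
by rewrite [(0 : 'rV[R]_2) 0 l]mxE subr0; ring.
Qed.

End Potential.

(** * The gradient of the Hamiltonian *)

(** Differentiating a double sum over pairs in one vortex meets the row and the column of [i0],
    which contribute equally. *)
Lemma sum_sym_delta (R : pzRingType) (I : finType) (P : rel I) (F : I -> I -> R) i0 :
  symmetric P ->
  \sum_i \sum_(j | P i j) ((i == i0)%:R * F i j + (j == i0)%:R * F j i) =
  2 * \sum_(j | P i0 j) F i0 j.
Proof.
move=> P_sym; under eq_bigr do rewrite big_split -mulr_sumr.
rewrite big_split /= sum_delta mulr_natl mulr2n; congr (_ + _).
rewrite (exchange_big_dep predT)//=.
under eq_bigr do rewrite -mulr_sumr.
by rewrite sum_delta; apply: eq_bigl => j; rewrite P_sym.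
Qed.

Section Hamiltonian.
Context {R : realType} {n : nat}.
Variables (rad a lam : R) (lams : 'I_n -> R).
Notation N := (2 + 2 + n * 2)%N.
Notation posE := (@posE R n).
Notation velE := (@velE R n).
Notation hamE := (hamE rad a lam lams).
Hypothesis rad_gt0 : 0 < rad.
Variable z : phase R n.
Hypothesis zP : phase_space rad z.
Implicit Types (i j : 'I_n) (k l m : 'I_2).
Notation r := (fun i => vortex z i 0).
Notation v := (velocity z 0).

Lemma Ir_eq i j k l : (Ir i k == Ir j l) = (i == j) && (k == l).
Proof. by rewrite enc_eq. Qed.

Lemma pd_posE i j k l :
  eval (pd (Ir i k) (posE j l)) z = (j == i)%:R * (l == k)%:R.
Proof. by rewrite /= Ir_eq -natrM mulnb. Qed.

(** Translation invariance: the r_i are measured from the center of the cylinder. *)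
Lemma ham_indep_center k : indep (Ic k) hamE.
Proof.
rewrite /= !enc_eq; apply/and4P; split=> //.
- by apply: indep_Sum => i _; rewrite /= !enc_eq.
- by do 2![apply: indep_Sum => ? _]; rewrite /= !enc_eq.
- by do 2![apply: indep_Sum => ? _]; rewrite /= !enc_eq.
Qed.

Lemma pd_ham_velocity k : eval (pd (Iv k) hamE) z = a * v k.
Proof.
rewrite [LHS]/= !eval_pd_indep; do ?[by do ?[apply: indep_Sum => ? _]; rewrite /= !enc_eq].
by rewrite !enc_eq /= velocityE; move: k; apply: forall_ord2 => /=; field.
Qed.

Definition dham i m : R :=
  - lam * lams i * r i m / sqn (r i)
  + lams i * \sum_j lams j * ((sqn (r j) * r i m - rad ^+ 2 * r j m) / image_dist rad (r i) (r j))
  - lams i * \sum_(j | j != i) lams j * ((r i m - r j m) / sqn (fun k => r i k - r j k)).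

Lemma eval_distE i j : eval (dotE (subE (posE i) (posE j)) (subE (posE i) (posE j))) z =
  sqn (fun k => r i k - r j k).
Proof. by rewrite eval_dotE /sqn /= !mulN1r !vortexE. Qed.

Lemma pd_sqn i m j : eval (pd (Ir i m) (dotE (posE j) (posE j))) z =
  (j == i)%:R * (2 * r j m).
Proof.
rewrite -[LHS]/(eval (pd (Ir i m) (posE j 0)) z * z 0 (Ir j 0)
  + z 0 (Ir j 0) * eval (pd (Ir i m) (posE j 0)) z
  + (eval (pd (Ir i m) (posE j 1)) z * z 0 (Ir j 1)
  + z 0 (Ir j 1) * eval (pd (Ir i m) (posE j 1)) z)) !pd_posE -!vortexE.
by move: m; apply: forall_ord2 => /=; ring.
Qed.

Lemma pd_image i m j j' : eval (pd (Ir i m) (imageE rad (posE j) (posE j'))) z =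
  (j == i)%:R * (2 * (sqn (r j') * r j m - rad ^+ 2 * r j' m))
  + (j' == i)%:R * (2 * (sqn (r j) * r j' m - rad ^+ 2 * r j m)).
Proof.
transitivity (- 2 * rad ^+ 2 *
   (eval (pd (Ir i m) (posE j 0)) z * r j' 0 + r j 0 * eval (pd (Ir i m) (posE j' 0)) z
   + (eval (pd (Ir i m) (posE j 1)) z * r j' 1 + r j 1 * eval (pd (Ir i m) (posE j' 1)) z))
   + (eval (pd (Ir i m) (dotE (posE j) (posE j))) z * sqn (r j')
   + sqn (r j) * eval (pd (Ir i m) (dotE (posE j') (posE j'))) z)).
  by rewrite /sqn /= !vortexE; ring.
rewrite !pd_posE !pd_sqn.
by move: m; apply: forall_ord2 => /=; ring.
Qed.

Lemma pd_dist i m j j' :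
  eval (pd (Ir i m) (dotE (subE (posE j) (posE j')) (subE (posE j) (posE j')))) z =
  (j == i)%:R * (2 * (r j m - r j' m)) + (j' == i)%:R * (2 * (r j' m - r j m)).
Proof.
transitivity (2 * ((r j 0 - r j' 0) *
  (eval (pd (Ir i m) (posE j 0)) z - eval (pd (Ir i m) (posE j' 0)) z)
  + (r j 1 - r j' 1) *
  (eval (pd (Ir i m) (posE j 1)) z - eval (pd (Ir i m) (posE j' 1)) z))).
  by rewrite /= !vortexE; ring.
rewrite !pd_posE.
by move: m; apply: forall_ord2 => /=; ring.
Qed.

Lemma pd_Ln (M : nat) (k : 'I_M) (c : R) (e : expr R M) p :
  eval (pd k (Mul (Cst c) (Ln e))) p = c * (eval (pd k e) p / eval e p).
Proof. by rewrite /= mul0r add0r. Qed.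

(** The coefficients 1/4 cancel against two factors 2: one from the quadratic arguments of the
    logarithms, absorbed in [F], the other from [sum_sym_delta]. On the diagonal of the image sum
    the latter arises because both arguments of [imageE] vary. *)
Lemma pd_ham_vortex i m : eval (pd (Ir i m) hamE) z = dham i m.
Proof.
have vel0 : eval (pd (Ir i m) (Mul (Cst (a / 2)) (dotE velE velE))) z = 0.
  by rewrite eval_pd_indep//= !enc_eq.
rewrite -[LHS]/(eval (pd (Ir i m) (Mul (Cst (a / 2)) (dotE velE velE))) z +
 (eval (pd (Ir i m) (Sum predT _)) z + (eval (pd (Ir i m) (Sum predT _)) z +
  eval (pd (Ir i m) (Sum predT _)) z))) vel0 add0r !pd_Sum !eval_Sum /dham addrA.
congr (_ + _ + _).
- under eq_bigr => j _ do rewrite pd_Ln pd_sqn eval_sqn.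
  rewrite -[RHS](sum_delta i (fun j => - lam * lams j * r j m / sqn (r j))).
  apply: eq_bigr => j _; field; exact: (sqn_vortex_neq0 rad_gt0 zP).
- under eq_bigr => j _ do rewrite pd_Sum eval_Sum.
  pose F j j' := lams j * lams j' / 2 *
    ((sqn (r j') * r j m - rad ^+ 2 * r j' m) / image_dist rad (r j) (r j')).
  transitivity (\sum_j \sum_(j' | (fun _ _ => true) j j')
      ((j == i)%:R * F j j' + (j' == i)%:R * F j' j)).
    apply: eq_bigr => j _; apply: eq_bigr => j' _.
    rewrite pd_Ln pd_image eval_imageE /F (image_dist_sym _ (r j')); field.
    exact: (image_dist_neq0 rad_gt0 zP).
  rewrite sum_sym_delta// mulr_sumr mulr_sumr; apply: eq_bigr => j _.
  by rewrite /F; field; exact: (image_dist_neq0 rad_gt0 zP).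
- under eq_bigr => j _ do rewrite pd_Sum eval_Sum.
  pose F j j' := - (lams j * lams j') / 2 * ((r j m - r j' m) / sqn (fun k => r j k - r j' k)).
  transitivity (\sum_j \sum_(j' | (fun j j' => j' != j) j j')
      ((j == i)%:R * F j j' + (j' == i)%:R * F j' j)).
    apply: eq_bigr => j _; apply: eq_bigr => j' jj'.
    rewrite pd_Ln pd_dist eval_distE /F.
    have -> : sqn (fun k => r j' k - r j k) = sqn (fun k => r j k - r j' k).
      by rewrite /sqn; ring.
    field; rewrite gt_eqF// -row2_neq; apply: zP.2; by rewrite eq_sym.
  rewrite sum_sym_delta; last by move=> j j'; rewrite eq_sym.
  rewrite !mulr_sumr -sumrN; apply: eq_bigr => j ij.
  rewrite /F; field; rewrite gt_eqF// -row2_neq; apply: zP.2; by rewrite eq_sym.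
Qed.

End Hamiltonian.

(** * The equations of motion *)

(** With A the Jacobian matrix of G, the tensor is A Om A^T: pull [h] back by A^T, apply Om, push
    forward by A. *)
Lemma poisson_tensor_sum (R : realType) (N : nat) (Om : 'I_N -> 'I_N -> R)
    (G : 'I_N -> expr R N) (h : 'I_N -> R) p i :
  \sum_k poisson_tensor Om G p i k * h k =
  \sum_b eval (pd b (G i)) p *
    \sum_c Om b c * \sum_k eval (pd c (G k)) p * h k.
Proof.
under eq_bigr => k _ do rewrite poisson_tensorE mulr_suml.
rewrite exchange_big; apply: eq_bigr => b _ /=; rewrite mulr_sumr.
under eq_bigr => k _ do rewrite mulr_suml.
rewrite exchange_big; apply: eq_bigr => c _ /=; rewrite !mulr_sumr.
by apply: eq_bigr => k _; ring.
Qed.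

Lemma derive1_coord (R : realType) (m : nat) (f : R -> 'rV[R]_m) t k :
  derivable f t 1 -> derive1 f t 0 k = derive1 (fun s => f s 0 k) t.
Proof. by move=> df; rewrite !derive1E derive_mx// mxE. Qed.

Section EquationsOfMotion.
Context {R : realType} {n : nat}.
Variables (rad a lam : R) (lams : 'I_n -> R).
Notation N := (2 + 2 + n * 2)%N.
Notation posE := (@posE R n).
Notation velE := (@velE R n).
Notation invE := (invE rad).
Notation hamE := (hamE rad a lam lams).
Notation liftE := (liftE rad a lams).
Hypotheses (rad_gt0 : 0 < rad) (a_gt0 : 0 < a) (lams_neq0 : forall i, lams i != 0).
Implicit Types (z : phase R n) (i j : 'I_n) (k l m : 'I_2) (b : 'I_N).

Definition impulseE i l : expr R N := subE (invE i) (posE i) l.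

Lemma impulse_indep_center i l k : indep (Ic k) (impulseE i l).
Proof. by rewrite /= !enc_eq. Qed.

Lemma impulse_indep_velocity i l k : indep (Iv k) (impulseE i l).
Proof. by rewrite /= !enc_eq. Qed.

Lemma liftE_center k : liftE (Ic k) = Var (Ic k).
Proof. by rewrite /liftE encK. Qed.

Lemma liftE_vortex i k : liftE (Ir i k) = posE i k.
Proof. by rewrite /liftE encK. Qed.

Definition total_impulseE k : expr R N :=
  Sum predT (fun i => Mul (Cst (lams i))
    (Sum predT (fun l => Mul (Cst (symp R k l)) (impulseE i l)))).

Lemma liftE_velocity k : liftE (Iv k) =
  Mul (Cst a^-1) (Add (velE k) (Mul (Cst (-1)) (total_impulseE k))).
Proof. by rewrite /liftE encK. Qed.

Lemma total_impulse_indep_center k l : indep (Ic l) (total_impulseE k).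
Proof. by do 2![apply: indep_Sum => ? _]; exact: impulse_indep_center. Qed.

Lemma total_impulse_indep_velocity k l : indep (Iv l) (total_impulseE k).
Proof. by do 2![apply: indep_Sum => ? _]; exact: impulse_indep_velocity. Qed.

Lemma pd_liftE_velocity k b z :
  eval (pd b (liftE (Iv k))) z =
  a^-1 * ((Iv k == b)%:R - eval (pd b (total_impulseE k)) z).
Proof. by rewrite liftE_velocity /=; ring. Qed.

Lemma pd_total_impulse k b z : eval (pd b (total_impulseE k)) z =
  \sum_i lams i * \sum_l symp R k l * eval (pd b (impulseE i l)) z.
Proof.
rewrite pd_Sum eval_Sum; apply: eq_bigr => i _.
rewrite [LHS]/= mul0r add0r pd_Sum eval_Sum; congr (_ * _).
by apply: eq_bigr => l _; rewrite [LHS]/= mul0r add0r.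
Qed.

(** [liftE] is affine in r_c and v with constant coefficients. *)
Lemma pd2_liftE (c : 'I_2 + 'I_2) b b' z :
  eval (pd (enc (inl c)) (pd b (liftE b'))) z = 0.
Proof.
rewrite -(decK b'); case: (dec b') => [[k|k]|[i k]].
- by rewrite liftE_center.
- have ind : indep (enc (inl c)) (total_impulseE k).
    case: c => l; [exact: total_impulse_indep_center|exact: total_impulse_indep_velocity].
  have := eval_pd_indep z (indep_pd b ind); have := eval_pd_indep z ind.
  rewrite liftE_velocity /= => -> ->; ring.
- by rewrite liftE_vortex.
Qed.

(** The chain rule required by the Jacobi identity: by [pd2_liftE] only vortex coordinates survive
    in the sum over l, and there [liftE] is the identity. *)
Lemma lift_hessian z b c b' :
  \sum_l eval (pd b (liftE l)) z * eval (pd l (pd c (liftE b'))) z =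
  eval (pd b (pd c (liftE b'))) z.
Proof.
rewrite sum_enc big1 ?add0r => [|k _]; last by rewrite pd2_liftE mulr0.
rewrite big1 ?add0r => [|k _]; last by rewrite pd2_liftE mulr0.
rewrite -(decK b); case: (dec b) => [d|[j l]].
  rewrite pd2_liftE big1// => i _; rewrite big1// => k _.
  by rewrite liftE_vortex /= enc_eq mul0r.
under eq_bigr => i _ do under eq_bigr => k _ do rewrite liftE_vortex pd_posE -mulrA.
under eq_bigr => i _ do rewrite -mulr_sumr sum_delta.
by rewrite sum_delta.
Qed.

Lemma omega_enc c d : omega lam lams (enc c) (enc d) = canonical_om lam lams c d.
Proof. by rewrite /omega !encK. Qed.

Variable z : phase R n.
Hypothesis zP : phase_space rad z.
Notation r := (fun i => vortex z i 0).
Notation v := (velocity z 0).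

(* The gradient of the Hamiltonian in the coordinates (r_c, pi, r_1, ..., r_n). *)
Definition cograd b : R :=
  \sum_c eval (pd b (liftE c)) z * eval (pd c hamE) z.

(** The Hamiltonian flow in the coordinates (r_c, pi, r_1, ..., r_n); the entry at [Iv k] is the
    derivative of pi_k. *)
Definition canonical_flow b : R := \sum_c omega lam lams b c * cograd c.

Lemma cogradE b : cograd b =
  \sum_k ((Iv k == b)%:R - eval (pd b (total_impulseE k)) z) * v k
  + \sum_i \sum_k (Ir i k == b)%:R * dham rad lam lams z i k.
Proof.
rewrite /cograd sum_enc big1 ?add0r => [|k _]; last first.
  by rewrite (eval_pd_indep _ (ham_indep_center _ _ _ _ _)) mulr0.
congr (_ + _).
  apply: eq_bigr => k _; rewrite pd_liftE_velocity pd_ham_velocity.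
  by field; rewrite gt_eqF.
apply: eq_bigr => i _; apply: eq_bigr => k _.
by rewrite liftE_vortex (pd_ham_vortex _ _ _ rad_gt0 zP).
Qed.

Lemma cograd_center k : cograd (Ic k) = 0.
Proof.
rewrite cogradE big1 ?add0r => [|l _]; last first.
  by rewrite enc_eq (eval_pd_indep _ (total_impulse_indep_center _ _)) subrr mul0r.
by rewrite big1// => i _; rewrite big1// => l _; rewrite enc_eq mul0r.
Qed.

Lemma cograd_velocity k : cograd (Iv k) = v k.
Proof.
rewrite cogradE [X in _ + X]big1 ?addr0 => [|i _]; last first.
  by rewrite big1// => l _; rewrite enc_eq mul0r.
under eq_bigr => l _ do
  rewrite enc_eq (eval_pd_indep _ (total_impulse_indep_velocity _ _)) subr0.
exact: (sum_delta k).
Qed.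

Lemma cograd_vortex i m : cograd (Ir i m) = dham rad lam lams z i m
  - \sum_k eval (pd (Ir i m) (total_impulseE k)) z * v k.
Proof.
rewrite cogradE addrC; congr (_ + _); last first.
  by rewrite -sumrN; apply: eq_bigr => k _; rewrite enc_eq sub0r mulNr.
under eq_bigr => j _ do under eq_bigr => l _ do rewrite Ir_eq -mulnb natrM -mulrA.
by under eq_bigr => j _ do rewrite -mulr_sumr sum_delta; rewrite sum_delta.
Qed.

Lemma flow_center k : canonical_flow (Ic k) = v k.
Proof.
rewrite /canonical_flow sum_enc.
rewrite big1 ?add0r => [|l _]; last by rewrite omega_enc mul0r.
rewrite [X in _ + X]big1 ?addr0 => [|i _]; last first.
  by rewrite big1// => l _; rewrite omega_enc mul0r.
under eq_bigr => l _ do rewrite omega_enc cograd_velocity /= eq_sym.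
exact: sum_delta.
Qed.

Lemma flow_velocity k : canonical_flow (Iv k) = lam * \sum_l symp R k l * v l.
Proof.
rewrite /canonical_flow sum_enc.
rewrite big1 ?add0r => [|l _]; last by rewrite cograd_center mulr0.
rewrite [X in _ + X]big1 ?addr0 => [|i _]; last first.
  by rewrite big1// => l _; rewrite omega_enc mul0r.
rewrite mulr_sumr; apply: eq_bigr => l _.
by rewrite omega_enc cograd_velocity mulrA.
Qed.

Lemma flow_vortex i k : canonical_flow (Ir i k) =
  - (lams i)^-1 * \sum_l symp R k l * cograd (Ir i l).
Proof.
rewrite /canonical_flow sum_enc.
rewrite big1 ?add0r => [|l _]; last by rewrite omega_enc mul0r.
rewrite big1 ?add0r => [|l _]; last by rewrite omega_enc mul0r.
transitivity (\sum_j (j == i)%:R *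
  (- (lams i)^-1 * \sum_l symp R k l * cograd (Ir j l))); last by rewrite sum_delta.
apply: eq_bigr => j _; rewrite !mulr_sumr; apply: eq_bigr => l _.
by rewrite omega_enc /= eq_sym; ring.
Qed.

Lemma pd_impulse i j l m : eval (pd (Ir i m) (impulseE j l)) z =
  (j == i)%:R * (rad ^+ 2 * ((l == m)%:R / sqn (r i)
    - 2 * r i l * r i m / sqn (r i) ^+ 2) - (l == m)%:R).
Proof.
transitivity (rad ^+ 2 * (eval (pd (Ir i m) (posE j l)) z / sqn (r j)
   - r j l * (eval (pd (Ir i m) (dotE (posE j) (posE j))) z / sqn (r j) ^+ 2))
   - eval (pd (Ir i m) (posE j l)) z).
  by rewrite -eval_sqn /= !vortexE -exprVn; ring.
rewrite pd_posE pd_sqn; case: eqP => [->|_] /=; last by ring.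
by field; rewrite (sqn_vortex_neq0 rad_gt0 zP).
Qed.

Lemma pd_total_impulse_vortex i k m : eval (pd (Ir i m) (total_impulseE k)) z =
  lams i * \sum_l symp R k l * (rad ^+ 2 * ((l == m)%:R / sqn (r i)
    - 2 * r i l * r i m / sqn (r i) ^+ 2) - (l == m)%:R).
Proof.
rewrite pd_total_impulse.
transitivity (\sum_j (j == i)%:R * (lams j * \sum_l symp R k l *
   (rad ^+ 2 * ((l == m)%:R / sqn (r i)
    - 2 * r i l * r i m / sqn (r i) ^+ 2) - (l == m)%:R))); last by rewrite sum_delta.
apply: eq_bigr => j _; rewrite !mulr_sumr; apply: eq_bigr => l _.
by rewrite pd_impulse; ring.
Qed.

(** The part [dham] of [cograd] yields the circulation, image and vortex terms. The impulse part
    yields - v and the dipole term: the derivative of inversion is a scaled reflection, which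
    conjugation by [symp] turns into its negative. *)
Lemma flow_vortexE i k : canonical_flow (Ir i k) =
  - v k + grad_regular_potential rad lam lams i z 0 k.
Proof.
rewrite flow_vortex (grad_regular_potentialE _ _ rad_gt0 zP) !sum_symp.
rewrite !cograd_vortex !sum_ord2 !pd_total_impulse_vortex !sum_symp /dham.
have ri0 := sqn_vortex_neq0 rad_gt0 zP i; have li0 := lams_neq0 i.
move: k; apply: forall_ord2; rewrite /= /sqn in ri0 *; by field; rewrite ri0 li0.
Qed.

Lemma hamiltonian_field b :
  \sum_k poisson_tensor (omega lam lams) liftE z b k * partial k (eval hamE) z =
  \sum_c eval (pd c (liftE b)) z * canonical_flow c.
Proof.
rewrite -poisson_tensor_sum; apply: eq_bigr => k _.
by rewrite partial_eval//; exact: hamE_defined.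
Qed.

Lemma hamiltonian_field_Var b : liftE b = Var b ->
  \sum_k poisson_tensor (omega lam lams) liftE z b k * partial k (eval hamE) z =
  canonical_flow b.
Proof.
move=> bE; rewrite hamiltonian_field bE.
under eq_bigr => c _ do rewrite /= eq_sym.
exact: sum_delta.
Qed.

(** As a v = pi - T with T = [total_impulseE], a v' is pi' minus the derivative of T along the
    flow. *)
Lemma hamiltonian_field_velocity k :
  \sum_c poisson_tensor (omega lam lams) liftE z (Iv k) c * partial c (eval hamE) z =
  a^-1 * (lam * \sum_l symp R k l * v l
    - \sum_i lams i * \sum_l symp R k l *
        \sum_c eval (pd c (impulseE i l)) z * canonical_flow c).
Proof.
rewrite hamiltonian_field -flow_velocity.
under eq_bigr => c _ do rewrite pd_liftE_velocity -mulrA mulrBl eq_sym pd_total_impulse.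
rewrite -mulr_sumr sumrB sum_delta; congr (_ * (_ - _)).
under eq_bigr => c _ do rewrite mulr_suml.
rewrite exchange_big; apply: eq_bigr => i _ /=; rewrite mulr_sumr.
under eq_bigr => c _ do rewrite -mulrA mulr_suml mulr_sumr.
rewrite exchange_big; apply: eq_bigr => l _ /=; rewrite !mulr_sumr.
by apply: eq_bigr => c _; ring.
Qed.

End EquationsOfMotion.

(** * Equivalence of the equations of motion with Hamilton's equations *)

Lemma inverse_pointE_eval (R : realType) (n : nat) (rad : R) (z : phase R n) i k :
  inverse_point rad (vortex z i) 0 k = eval (invE rad i k) z.
Proof.
by rewrite !mxE enorm_sqr -eval_sqn -mulrA [in RHS]/= [_^-1 * _]mulrC.
Qed.

(** The equations for v involve the velocities of the vortices, so in both directions they are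
    matched only after the equations for the r_i. *)
Lemma motion_equiv (R : realType) (n : nat) (rad a lam : R) (lams : 'I_n -> R)
    (zeta : R -> phase R n) (t : R) :
  0 < rad -> 0 < a -> (forall i, lams i != 0) ->
  phase_space rad (zeta t) -> derivable zeta t 1 ->
  equations_of_motion rad a lam lams zeta t <->
  hamiltonian_equations (eval (hamE rad a lam lams))
    (poisson_tensor (omega lam lams) (liftE rad a lams)) zeta t.
Proof.
move=> rad_gt0 a_gt0 lams_neq0 zP dzeta.
(* At [Iv k] the meanings differ: [dz] gives v_k' and [u] gives pi_k'. The two are compared on the
   vortex entries. *)
pose dz b := derive1 (fun s => zeta s 0 b) t.
pose u := canonical_flow rad a lam lams (zeta t).
have dvortex i : derivable (fun s => vortex (zeta s) i) t 1.
  apply/derivable_mxP => k0 k; rewrite ord1.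
  rewrite (_ : (fun s => _) = fun s => zeta s 0 (Ir i k)); last first.
    by apply: funext => s; rewrite vortexE.
  exact: ((derivable_mxP _ _ _).1 dzeta).
have dcenter : derivable (fun s => Defs.center (zeta s)) t 1.
  apply/derivable_mxP => k0 k; rewrite ord1.
  rewrite (_ : (fun s => _) = fun s => zeta s 0 (Ic k)); last first.
    by apply: funext => s; rewrite centerE.
  exact: ((derivable_mxP _ _ _).1 dzeta).
have dvE i k : derive1 (fun s => vortex (zeta s) i) t 0 k = dz (Ir i k).
  by rewrite derive1_coord//; congr (derive1 _ t); apply: funext => s; rewrite vortexE.
have dcE k : derive1 (fun s => Defs.center (zeta s)) t 0 k = dz (Ic k).
  by rewrite derive1_coord//; congr (derive1 _ t); apply: funext => s; rewrite centerE.
have dvelE k : derive1 (fun s => velocity (zeta s) 0 k) t = dz (Iv k).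
  by congr (derive1 _ t); apply: funext => s; rewrite velocityE.
have dimpE i k : derive1 (fun s => inverse_point rad (vortex (zeta s) i) 0 k) t
    - derive1 (fun s => vortex (zeta s) i 0 k) t =
    \sum_b eval (pd b (impulseE rad i k)) (zeta t) * dz b.
  rewrite (_ : (fun s => inverse_point _ _ _ _) =
      fun s => eval (invE rad i k) (zeta s)); last first.
    by apply: funext => s; rewrite inverse_pointE_eval.
  rewrite (_ : (fun s => vortex _ _ _ _) = fun s => eval (posE i k) (zeta s)); last first.
    by apply: funext => s; rewrite vortexE.
  rewrite !derive1_eval_curve//; last exact: invE_defined.
  by rewrite -sumrB; apply: eq_bigr => b _; rewrite /dz /=; ring.
(* The impulse depends on the vortices alone, so [dz] and [u] may be exchanged in these sums once
   they agree there. *)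
have impulse_eq (w w' : 'I_(2 + 2 + n * 2) -> R) i k : (forall j l, w (Ir j l) = w' (Ir j l)) ->
    \sum_b eval (pd b (impulseE rad i k)) (zeta t) * w b =
    \sum_b eval (pd b (impulseE rad i k)) (zeta t) * w' b.
  move=> ww'; rewrite !sum_enc.
  congr (_ + _ + _); apply: eq_bigr => l _.
  - by rewrite (eval_pd_indep _ (impulse_indep_center _ _ _ _)) !mul0r.
  - by rewrite (eval_pd_indep _ (impulse_indep_velocity _ _ _ _)) !mul0r.
  - by apply: eq_bigr => m _; rewrite ww'.
have ham_iff : hamiltonian_equations (eval (hamE rad a lam lams))
    (poisson_tensor (omega lam lams) (liftE rad a lams)) zeta t <->
    [/\ forall k, dz (Ic k) = velocity (zeta t) 0 k,
        forall i k, dz (Ir i k) = u (Ir i k) &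
        forall k, a * dz (Iv k) = lam * \sum_l symp R k l * velocity (zeta t) 0 l
          - \sum_i lams i * \sum_l symp R k l *
              \sum_b eval (pd b (impulseE rad i l)) (zeta t) * u b].
  have fc k := hamiltonian_field_Var lam rad_gt0 zP (liftE_center rad a lams k).
  have fr i k := hamiltonian_field_Var lam rad_gt0 zP (liftE_vortex rad a lams i k).
  have fv k := hamiltonian_field_velocity lam lams rad_gt0 a_gt0 zP k.
  split=> [ham|[ec er ev] b].
  - split=> [k|i k|k].
    + by rewrite /dz ham fc (flow_center lam lams rad_gt0 a_gt0 zP).
    + by rewrite /dz ham fr.
    + by rewrite /dz ham fv mulrA divff ?gt_eqF// mul1r.
  - rewrite -/(dz b) -(decK b); case: (dec b) => [[k|k]|[i k]].
    + by rewrite fc ec flow_center.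
    + by rewrite fv -ev mulrA mulVf ?gt_eqF// mul1r.
    + by rewrite fr er.
rewrite ham_iff; split=> [[er ec e1 e2]|[ec er ev]].
- have er' i k : dz (Ir i k) = u (Ir i k).
    by rewrite -dvE er !mxE /u flow_vortexE// !mxE.
  split=> // [k|k]; first by rewrite -dcE ec.
  (* [symp] selects the y component for k = 0 and minus the x component for k = 1, which accounts
     for the signs in the two equations for v. *)
  rewrite sum_symp; under eq_bigr => i _ do under eq_bigr => l _ do
    rewrite -(impulse_eq dz u i l er') -dimpE.
  under eq_bigr => i _ do rewrite sum_symp.
  rewrite -dvelE; move: k; apply: forall_ord2 => /=; first by rewrite e1.
  rewrite e2 mulrN mulNr; congr (_ + _).
  by rewrite -sumrN; apply: eq_bigr => i _; rewrite mulrN opprK.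
(* The same substitution backwards, with both values of k in one formula. *)
- have ev' k : a * derive1 (fun s => velocity (zeta s) 0 k) t =
     lam * (if k == 0 then velocity (zeta t) 0 1 else - velocity (zeta t) 0 0) -
     \sum_i lams i * (if k == 0 then
       derive1 (fun s => inverse_point rad (vortex (zeta s) i) 0 1) t
         - derive1 (fun s => vortex (zeta s) i 0 1) t
       else - (derive1 (fun s => inverse_point rad (vortex (zeta s) i) 0 0) t
         - derive1 (fun s => vortex (zeta s) i 0 0) t)).
    rewrite dvelE ev sum_symp; congr (_ - _); apply: eq_bigr => i _.
    by rewrite sum_symp !(impulse_eq u dz)// !dimpE.
  split.
  + by move=> i; apply/rowP => k; rewrite dvE er /u flow_vortexE// !mxE.
  + by apply/rowP => k; rewrite dcE ec.
  + by rewrite ev'.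
  + rewrite ev' /= mulrN mulNr; congr (_ + _).
    by rewrite -sumrN; apply: eq_bigr => i _; rewrite mulrN opprK.
Qed.

Unset Implicit Arguments.

Theorem proposition1 (R : realType) (n : nat) (rad a lam : R)
    (lams : 'I_n -> R) (n_ge1 : (1 <= n)%N) (rad_gt0 : 0 < rad) (a_gt0 : 0 < a)
    (lams_neq0 : forall i, lams i != 0) :
  exists (H : phase R n -> R) (J : phase R n -> 'M[R]_(2 + 2 + n * 2)),
    [/\ smooth_on (@phase_space R n rad) H,
        forall i j, smooth_on (@phase_space R n rad) (fun z => J z i j),
        forall z, phase_space rad z -> forall i j, J z i j = - J z j i,
        forall (zeta : R -> phase R n) (t : R),
          phase_space rad (zeta t) -> derivable zeta t 1 ->
          (equations_of_motion rad a lam lams zeta t <->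
           hamiltonian_equations H J zeta t)
      & jacobi_identity (@phase_space R n rad) J].
Proof.
have Dopen := @open_phase_space R n rad rad_gt0.
have dlift z b : phase_space rad z -> defined_at z (liftE rad a lams b).
  by move=> zP; exact: liftE_defined.
exists (eval (hamE rad a lam lams)).
exists (poisson_tensor (omega lam lams) (liftE rad a lams)); split.
- by apply: smooth_eval => // z zP; exact: hamE_defined.
- move=> i j; rewrite (_ : (fun z => _) = eval (bracket (omega lam lams) (liftE rad a lams) i j)).
    by apply: smooth_eval => // z zP; apply: bracket_defined => b; exact: dlift.
  by apply: funext => z; rewrite mxE.
- by move=> z _ i j; apply: poisson_tensor_anti; exact: omega_anti.
- by move=> zeta t zP dzeta; exact: motion_equiv.
- apply: poisson_tensor_jacobi; first exact: omega_anti.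
    by move=> z zP b; exact: dlift.
  by move=> z _ b c b'; exact: lift_hessian.
Qed.
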